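(* Suppose $(X, \tau, <)$ is a compact LOTS or, more generally, a locally countably compact GO-space. If $(X, \tau)$ is monotonically countably metacompact, then $X$ is metrizable.
   Context: A GO-space (generalized ordered space) is a triple $(X, \tau, <)$ where $<$ is a linear ordering of the set $X$ and $\tau$ is a Hausdorff topology on $X$ that has a base of convex subsets of $(X,<)$, possibly including some singletons. If $\tau$ is the usual open interval topology of $<$, then $(X,\tau,<)$ is called a linearly ordered topological space (LOTS). A space is locally countably compact if each point has a countably compact neighborhood. For two collections of sets $\mathcal{U}$ and $\mathcal{V}$, write $\mathcal{U} \prec \mathcal{V}$ if for each $U \in \mathcal{U}$ there is some $V \in \mathcal{V}$ with $U \subseteq V$. A space $X$ is monotonically countably metacompact (in the sense of Popvassilev) if there is a function $r$ that associates with each countable open cover $\mathcal{U}$ of $X$ a point-finite collection $r(\mathcal{U})$ of open sets that covers $X$ and satisfies $r(\mathcal{U}) \prec \mathcal{U}$, in such a way that if $\mathcal{U}$ and $\mathcal{V}$ are countable open covers of $X$ with $\mathcal{U} \prec \mathcal{V}$, then $r(\mathcal{U}) \prec r(\mathcal{V})$. (The collection $r(\mathcal{U})$ is not required to be countable.) *)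

(* Defs.v *)
From HB Require Import structures.
From mathcomp Require Import all_boot all_order all_algebra.
From mathcomp Require Import all_classical all_reals all_analysis.

Set Implicit Arguments.
Unset Strict Implicit.
Unset Printing Implicit Defensive.

Local Open Scope classical_set_scope.

Section ordered_spaces.
(* [POrderedTopological] imposes no compatibility between order and topology;
   linearity is asked for in [linear_order], as the library's join of total
   orders with topologies, [orderTopologicalType], forces the order topology. *)
Context {d} (T : POrderedTopological.type d).

Definition linear_order := total (<=%O : rel T).

Definition order_convex (A : set T) :=
  forall x y z : T, A x -> A z -> (x <= y)%O -> (y <= z)%O -> A y.

Definition GO_space :=
  [/\ linear_order, hausdorff_space T &
    exists2 B : set (set T), basis B & forall A, B A -> order_convex A].

(* The condition on neighborhoods is the axiom [itv_nbhsE] of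
   [orderTopologicalType]: the intervals ]a, b[, ]-oo, b[, ]a, +oo[ and
   ]-oo, +oo[ form a base. *)
Definition LOTS :=
  linear_order /\
  forall x : T, nbhs x = filter_from
    (fun i : interval T => itv_open_ends i /\ x \in i) (fun i => [set` i]).

End ordered_spaces.

Section topological_notions.
Context (T : topologicalType).
Implicit Types (A : set T) (C D : set (set T)).

(* [K] is countably compact as a subspace; countable includes finite. *)
Definition countably_compact (K : set T) :=
  forall C, countable C -> C `<=` open -> K `<=` \bigcup_(A in C) A ->
    exists D, [/\ D `<=` C, finite_set D & K `<=` \bigcup_(A in D) A].

Definition locally_countably_compact :=
  forall x : T, exists2 K, nbhs x K & countably_compact K.

Definition open_cover C := C `<=` open /\ \bigcup_(A in C) A = [set: T].

Definition prec C D := forall A, C A -> exists2 B, D B & A `<=` B.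

Definition point_finite C := forall x : T, finite_set [set A | C A /\ A x].

(* The values of [r] outside the countable open covers are irrelevant. *)
Definition monotonically_countably_metacompact :=
  exists r : set (set T) -> set (set T),
    (forall C, countable C -> open_cover C ->
      [/\ open_cover (r C), point_finite (r C) & prec (r C) C]) /\
    (forall C D, countable C -> open_cover C -> countable D -> open_cover D ->
      prec C D -> prec (r C) (r D)).

(* Homeomorphic to a metric space. *)
Definition metrizable (R : realType) :=
  exists (M : metricType R) (f : T -> M) (g : M -> T),
    [/\ cancel f g, cancel g f, continuous f & continuous g].

End topological_notions.

(* Main.v *)
Require Import Defs.
From HB Require Import structures.
From mathcomp Require Import all_boot all_order all_algebra.
From mathcomp Require Import all_classical all_reals all_analysis.
From mathcomp Require Import lra.

(* For a < c let r(a, c) be the refinement assigned to the two-ray cover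
   {(<-, c), (a, ->)}.  The member of r(a, c) containing a lies in (<-, c).  If
   a_0 < c_0 < a_1 < c_1 < ... and one point q <= a_0 lay in such members for
   all k, then comparing with the cover {(<-, c_k)}_k + {(a_0, ->)} would give
   infinitely many members of its refinement around q, as each of them is
   bounded by some c_j; this contradicts point-finiteness.
   In a countably compact segment, take a countable set D closed under
   reflection of finitely many first-order conditions.  At a gap (a, b) of D, an
   endpoint not in D is a limit of D, so the member of r(a, c) at a contains
   some q in D; reflecting this fact inside D, again and again closer to a,
   yields a forbidden sequence.  Hence D has no gaps; the same argument with c
   beyond sup D excludes uncountable cofinality.  So each class of the relation
   "the segment between x and y is countably compact" is clopen and second
   countable; being locally compact it carries a sequence of continuous
   functions inducing its topology, and these give a metric on the whole space,
   different classes being at distance 1. *)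

Set Implicit Arguments.
Unset Strict Implicit.
Unset Printing Implicit Defensive.

Import Order.TTheory GRing.Theory Num.Theory.
Import numFieldNormedType.Exports.
Local Open Scope order_scope.
Local Open Scope classical_set_scope.

(* The reverse order with the same topology: every one-sided statement below
   is proved once and transferred to the other side through [T^d]. *)
HB.instance Definition _ d (T : POrderedTopological.type d) :=
  Topological.copy T^d T.

(** * Countable sets reflecting countably many conditions *)

(** A downward Loewenheim-Skolem argument: Skolem functions [F] choose witness lists, and [e]
    enumerates the values of all terms built from them, which are countably many because terms are
    finite trees. *)
Lemma elementary_enumeration (T : Type) (x0 : T)
    (P : nat -> seq T -> seq T -> Prop) :
  exists e : nat -> T, forall i ns, (exists ws, P i (map e ns) ws) ->
    exists ms, P i (map e ns) (map e ms).
Proof.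
have [F FP] : exists F : nat -> seq T -> seq T,
    forall i ps, (exists ws, P i ps ws) -> P i ps (F i ps).
  have /choice[F FP] : forall ips : nat * seq T, exists ws,
      (exists ws', P ips.1 ips.2 ws') -> P ips.1 ips.2 ws.
    move=> [i ps] /=; have [[ws Pws]|nP] := pselect (exists ws, P i ps ws).
      by exists ws.
    by exists [::] => /nP.
  by exists (fun i ps => F (i, ps)) => i ps; apply: (FP (i, ps)).
(* A node whose label codes [(i, j)] denotes entry [j] of the witness list chosen for condition [i]
   at the values of its subtrees. *)
pose fix eval (t : GenTree.tree nat) : T := match t with
  | GenTree.Leaf _ => x0
  | GenTree.Node k ts =>
      let ij := odflt (0, 0)%N (unpickle k) in
      nth x0 (F ij.1 (map eval ts)) ij.2 end.
pose tree n : GenTree.tree nat := odflt (GenTree.Leaf 0) (unpickle n).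
exists (eval \o tree) => i ns /FP PF.
pose node (j : nat) := GenTree.Node (pickle (i, j)) (map tree ns).
exists [seq pickle (node j) | j <- iota 0 (size (F i (map (eval \o tree) ns)))].
set ws := F i _ in PF *.
suff -> : map (eval \o tree) [seq pickle (node j) | j <- iota 0 (size ws)] = ws.
  exact: PF.
rewrite -map_comp -[RHS](mkseq_nth x0); apply: eq_map => j.
by rewrite /= /tree pickleK /= pickleK /= -map_comp.
Qed.

(** * Countable and countably compact sets *)

Lemma countable_setU (T : Type) (A B : set T) :
  countable A -> countable B -> countable (A `|` B).
Proof.
move=> cA cB; rewrite -bigcup2E; apply: bigcup_countable => // -[|[|n]] _ //=.
Qed.

Lemma countable_img (T U : Type) (f : T -> U) (A : set T) :
  countable A -> countable (f @` A).
Proof. by apply: sub_countable; exact: card_image_le. Qed.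

Section countably_compact_sets.
Context {T : topologicalType}.

Lemma sub_countably_compact (A K : set T) :
  closed A -> A `<=` K -> countably_compact K -> countably_compact A.
Proof.
move=> cA AK cK C cC oC AC.
have [||x Kx|D [DC fD KD]] := cK (C `|` [set ~` A]).
- by by apply: countable_setU => //; exact: countable1.
- by move=> B [/oC//|->]; exact: closed_openC.
- have [/AC[B CB Bx]|nAx] := pselect (A x); first by exists B => //; left.
  by exists (~` A) => //; right.
exists (D `&` C); split=> [B []//||x Ax]; first exact: finite_setIl.
by have [B DB Bx] := KD _ (AK _ Ax); exists B => //; split=> //;
   case: (DC _ DB) => // BE; move: Bx; rewrite BE.
Qed.

Lemma countably_compactU (A B : set T) :
  countably_compact A -> countably_compact B -> countably_compact (A `|` B).
Proof.
move=> cA cB C cC oC ABC.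
have [|D [DC fD AD]] := cA C cC oC; first by move=> x Ax; apply: ABC; left.
have [|E [EC fE BE]] := cB C cC oC; first by move=> x Bx; apply: ABC; right.
exists (D `|` E); split; first by move=> x [/DC|/EC].
  by rewrite finite_setU.
by move=> x [/AD|/BE] [G ? ?]; exists G => //; [left|right].
Qed.

(** If a filter containing [K] has no cluster point in [K], the sets [B n] whose complements belong
    to the filter cover [K]; a finite subcover puts the empty set into the filter. *)
Lemma countably_compact_compact (K : set T) (B : nat -> set T) :
    (forall n, open (B n)) ->
    (forall x U, K x -> open U -> U x -> exists n, B n x /\ B n `<=` U) ->
  countably_compact K -> compact K.
Proof.
move=> oB bB cK F FF FK; apply: contrapT => nclus.
have [|_ [n _ <-]|x Kx|D [DC fD KD]] :=
    cK [set B n | n in [set n | F (~` B n)]].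
- by apply: countable_img; exact: countableP.
- exact: oB.
- have : ~ cluster F x by move=> Fx; apply: nclus; exists x.
  move=> /existsNP[A] /existsNP[U] /not_implyP[FA] /not_implyP[].
  rewrite nbhsE => -[V [oV Vx] VU] AU.
  have [n [Bx BV]] := bB x V Kx oV Vx.
  exists (B n) => //; exists n => //=; apply: filterS FA => y Ay By; apply: AU.
  by exists y; split => //; apply: VU; apply: BV.
have FD : F (\bigcap_(A in D) ~` A).
  case/finite_fsetP: fD DC => S -> SC.
  by apply: filter_bigI => A /SC[n ? <-].
suff : F set0 by exact: filter_not_empty.
by apply: filterS2 FD FK => x Dx /KD[A DA]; apply: Dx.
Qed.

End countably_compact_sets.

(** * Linear orders with open rays *)

Section ray_space.
Context d (T : POrderedTopological.type d).

(** What the order arguments need from a GO-space; it is stable under reversal of the order. *)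
Definition ray_space := [/\ linear_order T,
  forall a : T, open [set x | a < x] & forall a : T, open [set x | x < a]].

Definition segment (p q : T) := [set x | p <= x <= q].

Hypothesis rT : ray_space.
Implicit Types x y z : T.

Lemma ray_ltNge x y : (x < y) = ~~ (y <= x).
Proof. by case: rT => tot _ _; apply: comparable_ltNge; apply: tot. Qed.

Lemma ray_leNgt x y : (x <= y) = ~~ (y < x).
Proof. by case: rT => tot _ _; apply: comparable_leNgt; apply: tot. Qed.

Lemma segment_closed p q : closed (segment p q).
Proof.
have [_ op ol] := rT.
rewrite -openC (_ : ~` _ = [set x | x < p] `|` [set x | q < x]).
  by apply: openU; [exact: ol|exact: op].
apply/seteqP; split => x /=; rewrite /segment /=.
  by move=> /negP; rewrite negb_and -!ray_ltNge => /orP.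
by rewrite !ray_ltNge => -[]/negP h /andP[] /[swap].
Qed.

(** Here [a] is the supremum of [L]. Without it, the rays below points of [L] and the complement of
    [closure L] would cover the segment, but finitely many of them miss the largest of the points of
    [L] that bound the chosen rays. *)
Lemma ub_closure (L : set T) p q : countably_compact (segment p q) ->
    countable L -> L `<=` segment p q -> L !=set0 ->
  exists a, [/\ p <= a <= q, closure L a & forall x, L x -> x <= a].
Proof.
move=> cK cL LK [l0 Ll0]; apply: contrapT => nsup.
have [_ op ol] := rT.
have [|B|x Kx|D [DC fD KD]] :=
    cK ([set [set x | x < l] | l in L] `|` [set ~` closure L]).
- by apply: countable_setU; [exact: countable_img|exact: countable1].
- by case=> [[l _ <-]|->]; [exact: ol|apply: closed_openC; exact: closed_closure].
- have [[l Ll xl]|nub] := pselect (exists2 l, L l & x < l).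
    by exists [set x | x < l] => //; left; exists l.
  exists (~` closure L); [by right|move=> clx; apply: nsup; exists x; split=> //].
  by move=> l Ll; rewrite ray_leNgt; apply/negP => xl; apply: nub; exists l.
have [s DE] : exists s : seq (set T), D = [set` s] by apply/finite_seqP.
have [m Lm mD] : exists2 m, L m &
    forall A x, A \in s -> L x -> A x -> x < m.
  have : forall A, A \in s ->
      ([set [set x | x < l] | l in L] `|` [set ~` closure L]) A.
    by move=> A As; apply: DC; rewrite DE.
  elim: s {DE} => [_|A s IH sC]; first by exists l0.
  have [|m Lm mD] := IH; first by move=> B Bs; apply: sC; rewrite inE Bs orbT.
  case: (sC A); first by rewrite inE eqxx.
    move=> [l Ll AE]; have [ml|lm] := boolP (m < l).
      exists l => // B x; rewrite inE => /predU1P[->|Bs Lx Bx].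
        by rewrite -AE.
      by apply: lt_trans ml; exact: mD Bx.
    exists m => // B x; rewrite inE => /predU1P[->|Bs Lx Bx]; last exact: mD Bx.
    by rewrite -AE /= => _ xl; rewrite -ray_leNgt in lm; exact: lt_le_trans lm.
  move=> ->; exists m => // B x; rewrite inE => /predU1P[->|Bs Lx Bx].
    by move=> Lx /(_ (subset_closure Lx)).
  exact: mD Bx.
have [A DA Am] := KD _ (LK _ Lm); rewrite DE in DA.
by have := mD A m DA Lm Am; rewrite ltxx.
Qed.

End ray_space.

Lemma ray_space_dual d (T : POrderedTopological.type d) :
  ray_space T -> ray_space T^d.
Proof. by case=> tot op ol; split => // x y; rewrite orbC; exact: tot. Qed.

Lemma segment_dual d (T : POrderedTopological.type d) (p q : T) :
  @segment _ T^d q p = segment p q.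
Proof. by apply/seteqP; split => x /=; rewrite /segment /= andbC. Qed.

Lemma lb_closure d (T : POrderedTopological.type d) (L : set T) (p q : T) :
    ray_space T -> countably_compact (segment p q) ->
    countable L -> L `<=` segment p q -> L !=set0 ->
  exists a, [/\ p <= a <= q, closure L a & forall x, L x -> a <= x].
Proof.
move=> /ray_space_dual rT cK cL LK L0.
have [||a [pq cl ub]] := @ub_closure _ T^d rT L q p _ cL _ L0.
- by rewrite segment_dual.
- by rewrite segment_dual.
by exists a; split => //; rewrite andbC.
Qed.

(** * Point-finiteness and sequences of two-ray covers *)

Definition mcm_operator (T : topologicalType) (r : set (set T) -> set (set T)) :=
  (forall C, countable C -> open_cover C ->
    [/\ open_cover (r C), point_finite (r C) & prec (r C) C]) /\
  (forall C D, countable C -> open_cover C -> countable D -> open_cover D ->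
    prec C D -> prec (r C) (r D)).

Section links.
Context d (T : POrderedTopological.type d).
Variable r : set (set T) -> set (set T).
Implicit Types (a b c q s x y z : T) (D : set T).

Definition two_rays a c := [set [set x | x < c]] `|` [set [set x | a < x]].

(* For [x = a] the common member is forced into [set y | y < c], for [x = c]
   into [set y | a < y]. *)
Definition linked q x a c :=
  exists V, [/\ r (two_rays a c) V, V q & V x].

(** To be reflected into a set [D] with a gap between some point and [u]. The alternative allows
    [c = u] only at a jump, so a pair found in [D] cannot straddle the missing lower end of the
    gap. *)
Definition linked_below q l u a c :=
  [/\ l < a, a < c, c <= u, c < u \/ ~ (exists y, a < y < u) &
      linked q a a c].

(* The alternative on [m1], [m2] prevents witnesses taken in a set [D] from
   surrounding a gap of [D]: either [m1 = m2] would lie in the gap, or the jump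
   [a < b] would contain it. *)
Definition linked_around q s l u a m1 m2 b :=
  [/\ [/\ l < a, a < b & b < u], a < m1 <= b, a <= m2 < b,
      m1 = m2 \/ ~ (exists y, a < y < b) &
      linked q a a m1 /\ linked s b m2 b].

Hypothesis rT : ray_space T.
Hypothesis rr : mcm_operator r.

Lemma two_rays_cover a c : a < c ->
  countable (two_rays a c) /\ open_cover (two_rays a c).
Proof.
move=> ac; have [_ op ol] := rT; split.
  by apply: countable_setU; exact: countable1.
split; first by move=> A [->|->]; [exact: ol|exact: op].
rewrite -subTset => x _; have [xc|] := boolP (x < c).
  by exists [set x | x < c] => //; left.
rewrite -(ray_leNgt rT) => cx; exists [set x | a < x]; first by right.
exact: lt_le_trans cx.
Qed.

(** The member of the refinement that contains [x] is a neighborhood of [x], hence meets [L]. *)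
Lemma linked_closure a c (L : set T) x : a < c -> closure L x ->
  exists2 q, L q & linked q x a c.
Proof.
move=> /two_rays_cover[cC oC] clx; have [[oR RT] _ _] := rr.1 _ cC oC.
have [V RV Vx] : (\bigcup_(V in r (two_rays a c)) V) x by rewrite RT.
have [q [Lq Vq]] := clx V (open_nbhs_nbhs (conj (oR _ RV) Vx)).
by exists q => //; exists V.
Qed.

Lemma no_increasing_links (a c : nat -> T) q : q <= a 0 ->
    (forall k, a k < c k) -> (forall k, c k < a k.+1) ->
    (forall k, linked q (a k) (a k) (c k)) -> False.
Proof.
move=> qa ac ca qlink; have [_ op ol] := rT.
have amono m n : (m <= n)%N -> a m <= a n.
  apply: (homo_leq (r := <=%O)) => [//|? ? ?|k]; first exact: le_trans.
  exact: ltW (lt_trans (ac k) (ca k)).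
have cmono m n : (m <= n)%N -> c m <= c n.
  apply: (homo_leq (r := <=%O)) => [//|? ? ?|k]; first exact: le_trans.
  exact: ltW (lt_trans (ca k) (ac k.+1)).
pose W := [set [set x | x < c k] | k in [set: nat]] `|` [set [set x | a 0 < x]].
have cW : countable W.
  by apply: countable_setU; [apply: countable_img; exact: countableP|
                             exact: countable1].
have oW : open_cover W.
  split; first by move=> A [[k _ <-]|->]; [exact: ol|exact: op].
  rewrite -subTset => x _; have [xc|] := boolP (x < c 0).
    by exists [set x | x < c 0] => //; left; exists 0.
  rewrite -(ray_leNgt rT) => cx; exists [set x | a 0 < x]; first by right.
  by apply: lt_le_trans cx; exact: ac.
(* Each two-ray cover refines [W], so by monotonicity its linking member is contained in a member of
   [r W]. *)
have /choice[B BW] : forall k, exists B, [/\ r W B, B q & B (a k)].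
  move=> k; have [V [RV Vq Va]] := qlink k.
  have [cC oC] := two_rays_cover (ac k).
  have CW : prec (two_rays (a k) (c k)) W.
    move=> A [->|->]; first by exists [set x | x < c k] => //; left; exists k.
    exists [set x | a 0 < x]; first by right.
    by move=> x; apply: le_lt_trans; exact: amono.
  have [B RB VB] := rr.2 _ _ cC oC cW oW CW _ RV.
  by exists B; split => //; exact: VB.
have [_ fW rW] := rr.1 _ cW oW.
have [s sE] : exists s : seq (set T), [set A | r W A /\ A q] = [set` s].
  by apply/finite_seqP.
(* Since [q <= a 0], a member around [q] cannot lie in the upper ray, so it lies below some [c k];
   finitely many members have a common bound [c J], which [a J.+1] exceeds. *)
have [J JB] : exists J, forall A x, A \in s -> A x -> x < c J.
  have : forall A, A \in s -> r W A /\ A q.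
    by move=> A As; have : [set` s] A by []; rewrite -sE.
  elim: s {sE} => [_|A s IH sC]; first by exists 0.
  have [|J JB] := IH; first by move=> B' Bs; apply: sC; rewrite inE Bs orbT.
  have [RA Aq] := sC A (mem_head _ _).
  have [A' [[k _ <-]|->] AA'] := rW _ RA; last first.
    by have /= := AA' _ Aq; rewrite (ray_ltNge rT) qa.
  exists (maxn J k) => B' x; rewrite inE => /predU1P[->|Bs B'x].
    by move=> /AA' /= xk; apply: lt_le_trans xk _; apply: cmono; exact: leq_maxr.
  by apply: lt_le_trans (JB _ _ Bs B'x) _; apply: cmono; exact: leq_maxl.
have [RB Bq Ba] := BW J.+1.
have : B J.+1 \in s by have : [set` s] (B J.+1) by rewrite -sE.
move=> /JB /(_ Ba); rewrite (ray_ltNge rT) => /negP; apply.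
exact: ltW (ca J).
Qed.

(** Starting from [q], each upper end [c'] found in [D] is the next lower bound [l]; the pairs
    obtained form a sequence excluded by [no_increasing_links]. *)
Lemma no_links_below D a q : D q -> q < a ->
    (forall l, D l -> q <= l -> l < a -> exists a' c',
      [/\ D c', l < a', a' < c', c' < a & linked q a' a' c']) ->
  False.
Proof.
move=> Dq qa step.
have /choice[g gP] : forall l, exists ac : T * T, D l -> q <= l -> l < a ->
    [/\ D ac.2, l < ac.1, ac.1 < ac.2, ac.2 < a & linked q ac.1 ac.1 ac.2].
  move=> l; have [[Dl ql la]|nP] := pselect [/\ D l, q <= l & l < a].
    by have [a' [c' ?]] := step l Dl ql la; exists (a', c').
  by exists (q, q) => Dl ql la; case: nP.
pose l k := iter k (fun l => (g l).2) q.
have lP k : [/\ D (l k), q <= l k & l k < a].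
  elim: k => [|k [Dl ql la]]; first by split.
  have [Dc lac ac ca _] := gP _ Dl ql la; split => //.
  by apply: le_trans ql (le_trans (ltW lac) (ltW ac)).
apply: (@no_increasing_links (fun k => (g (l k)).1) (fun k => (g (l k)).2) q).
- have [Dl ql la] := lP 0; have [_ + _ _ _] := gP _ Dl ql la.
  exact: ltW.
- by move=> k; have [Dl ql la] := lP k; have [] := gP _ Dl ql la.
- by move=> k; have [Dl ql la] := lP k.+1; have [] := gP _ Dl ql la.
- by move=> k; have [Dl ql la] := lP k; have [] := gP _ Dl ql la.
Qed.

Lemma no_gap_below D a b :
    (forall q l u, D q -> D l -> D u -> (exists a c, linked_below q l u a c) ->
      exists a c, [/\ D a, D c & linked_below q l u a c]) ->
    ~ D a -> D b -> a < b -> (forall x, D x -> a < x -> b <= x) ->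
  ~ closure (D `&` [set x | x <= a]) a.
Proof.
move=> refl Da Db ab gap cla.
have neq x : D x -> x <= a -> x < a.
  by move=> Dx; rewrite le_eqVlt => /predU1P[xa|//]; rewrite xa in Dx.
(* A point strictly inside the gap is preferred; [b] itself is taken only at a jump. *)
have [c [ac cb cbE]] : exists c,
    [/\ a < c, c <= b & c < b \/ ~ (exists y, a < y < b)].
  have [[y /andP[ay yb]]|jump] := pselect (exists y, a < y < b).
    by exists y; split; [|exact: ltW|left].
  by exists b; split => //; right.
have [q [Dq qa] qlink] := linked_closure ac cla.
apply: (@no_links_below D a q) => //; first exact: neq.
move=> l Dl ql la.
have [|a' [c' [Da' Dc' [la' ac' cb' cbE' link']]]] := refl q l b Dq Dl Db.
  by exists a, c; split.
exists a', c'; split=> //; apply: (neq c') => //.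
rewrite (ray_leNgt rT); apply/negP => /(gap _ Dc') bc'.
case: cbE' => [|[]]; first by rewrite (ray_ltNge rT) bc'.
exists a; rewrite ab andbT; apply: neq => //.
rewrite (ray_leNgt rT); apply/negP => /(gap _ Da').
by rewrite (ray_leNgt rT) (lt_le_trans ac' cb').
Qed.

End links.

Section links_dual.
Context d (T : POrderedTopological.type d).
Variable r : set (set T) -> set (set T).
Implicit Types (a b c q s x y z : T) (D : set T).

Lemma linked_dual q x a c :
  @linked _ T^d r q x c a = linked r q x a c.
Proof. by rewrite /linked /two_rays setUC. Qed.

Hypothesis rT : ray_space T.
Hypothesis rr : mcm_operator r.
Let rTd := ray_space_dual rT.

Lemma no_links_above D b s : D s -> b < s ->
    (forall u, D u -> u <= s -> b < u -> exists m b',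
      [/\ D m, b < m, m < b', b' < u & linked r s b' m b']) ->
  False.
Proof.
move=> Ds bs step; apply: (@no_links_below _ T^d r rTd rr D b s) => // u Du us bu.
have [m [b' [? ? ? ? link]]] := step u Du us bu.
by exists b', m; split => //; rewrite linked_dual.
Qed.

Lemma no_gap_around D a b :
    (forall q s l u, D q -> D s -> D l -> D u ->
      (exists a m1 m2 b, linked_around r q s l u a m1 m2 b) ->
      exists a m1 m2 b, [/\ D a, D m1, D m2, D b &
        linked_around r q s l u a m1 m2 b]) ->
    ~ D a -> ~ D b -> a < b -> (forall x, D x -> a < x -> b <= x) ->
    closure (D `&` [set x | x <= a]) a -> ~ closure (D `&` [set x | b <= x]) b.
Proof.
move=> refl Da Db ab gap cla clb.
have neqa x : D x -> x <= a -> x < a.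
  by move=> Dx; rewrite le_eqVlt => /predU1P[xa|//]; rewrite xa in Dx.
have neqb x : D x -> a < x -> b < x.
  move=> Dx /(gap _ Dx); rewrite le_eqVlt => /predU1P[bx|//].
  by rewrite -bx in Dx.
(* A point inside the gap serves as both [m1] and [m2]; at a jump they are the opposite ends [b] and
   [a]. *)
have [m1 [m2 [m1P m2P mE]]] : exists m1 m2,
    [/\ a < m1 <= b, a <= m2 < b & m1 = m2 \/ ~ (exists y, a < y < b)].
  have [[y /andP[ay yb]]|jump] := pselect (exists y, a < y < b).
    by exists y, y; rewrite ay (ltW ay) yb (ltW yb); split => //; left.
  by exists b, a; rewrite ab !lexx; split => //; right.
have /andP[am1 m1b] := m1P; have /andP[am2 m2b] := m2P.
have [q [Dq qa] qlink] := linked_closure rT rr am1 cla.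
have [s [Ds sb] slink] := linked_closure rT rr m2b clb.
have {}qa := neqa _ Dq qa; have {}sb : b < s.
  by apply: neqb => //; exact: lt_le_trans sb.
(* A reflected configuration lies in [D] and so avoids the gap: one of its two linked pairs lies
   entirely below [a] or entirely above [b]. *)
have step l u : D l -> l < a -> D u -> b < u ->
    (exists a' c', [/\ D c', l < a', a' < c', c' < a & linked r q a' a' c']) \/
    (exists m b', [/\ D m, b < m, m < b', b' < u & linked r s b' m b']).
  move=> Dl la Du bu.
  have [|a' [n1 [n2 [b' [Da' Dn1 Dn2 Db']]]]] := refl q s l u Dq Ds Dl Du.
    by exists a, m1, m2, b; split.
  move=> [[la' ab' bu'] /andP[an1 n1b] /andP[an2 n2b] nE [link1 link2]].
  have [an1'|n1a] := boolP (a < n1); last first.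
    left; exists a', n1; split => //; apply: neqa => //.
    by rewrite (ray_leNgt rT).
  right; exists n2, b'; split => //; apply: neqb => //.
  case: nE => [<-//|jump]; rewrite (ray_ltNge rT); apply/negP => n2a.
  apply: jump; exists a.
  by rewrite (neqa _ Da' (le_trans an2 n2a)) (lt_le_trans an1' n1b).
(* Either pairs below [a] occur beyond every [l], or some [l] admits none and, kept fixed, forces
   pairs above [b] under every [u]. *)
have [below|/existsNP[l /not_implyP[Dl /not_implyP[la nbelow]]]] := pselect
    (forall l, D l -> l < a -> exists a' c',
      [/\ D c', l < a', a' < c', c' < a & linked r q a' a' c']).
  by apply: (no_links_below rT rr Dq qa) => l Dl _; exact: below.
apply: (no_links_above Ds sb) => u Du _ bu.
by have [] := step l u Dl la Du bu.
Qed.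

End links_dual.

(** * Countable sets without gaps *)

Section countable_order_dense.
Context d (T : POrderedTopological.type d).
Variable r : set (set T) -> set (set T).
Hypothesis rT : ray_space T.
Hypothesis rr : mcm_operator r.
Implicit Types (p q x y : T).

Lemma interval_enumeration p q : p <= q -> countably_compact (segment p q) ->
  exists e : nat -> T, [/\ range e p, range e q &
    forall x, p <= x <= q -> ~ range e x ->
      closure (range e `&` [set y | p <= y < x]) x /\
      closure (range e `&` [set y | x < y <= q]) x].
Proof.
move=> pq ccK.
(* Condition 0 puts [p] and [q] into the range. Conditions 1 to 4 exclude gaps with both ends, only
   the right end, only the left end, and no end in the range. *)
pose P (i : nat) (ps ws : seq T) : Prop := match i, ps, ws with
  | 0, [::], [:: a; b] => a = p /\ b = q
  | 1, [:: l; u], [:: m] => l < m < u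
  | 2, [:: q; l; u], [:: a; c] => linked_below r q l u a c
  | 3, [:: q; l; u], [:: a; c] => @linked_below _ T^d r q l u a c
  | 4, [:: q; s; l; u], [:: a; m1; m2; b] => linked_around r q s l u a m1 m2 b
  | _, _, _ => False end.
have [e eP] := elementary_enumeration p P.
pose D := range e; have De n : D (e n) by exists n.
have [Dp Dq] : D p /\ D q.
  have [|[|n1 [|n2 [|? ?]]] //= [<- <-] //] := eP 0 [::].
  by exists [:: p; q].
have D1 l u : D l -> D u -> (exists m, l < m < u) -> exists2 m, D m & l < m < u.
  case=> [nl _ <-] [nu _ <-] [m lmu].
  have [|[|n1 [|? ?]] //= ?] := eP 1 [:: nl; nu]; first by exists [:: m].
  by exists (e n1).
have D2 q' l u : D q' -> D l -> D u -> (exists a c, linked_below r q' l u a c) ->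
    exists a c, [/\ D a, D c & linked_below r q' l u a c].
  case=> [nq _ <-] [nl _ <-] [nu _ <-] [a [c lac]].
  have [|[|n1 [|n2 [|? ?]]] //= ?] := eP 2 [:: nq; nl; nu].
    by exists [:: a; c].
  by exists (e n1), (e n2).
have D3 q' l u : D q' -> D l -> D u ->
    (exists a c, @linked_below _ T^d r q' l u a c) ->
    exists a c, [/\ D a, D c & @linked_below _ T^d r q' l u a c].
  case=> [nq _ <-] [nl _ <-] [nu _ <-] [a [c lac]].
  have [|[|n1 [|n2 [|? ?]]] //= ?] := eP 3 [:: nq; nl; nu].
    by exists [:: a; c].
  by exists (e n1), (e n2).
have D4 q' s l u : D q' -> D s -> D l -> D u ->
      (exists a m1 m2 b, linked_around r q' s l u a m1 m2 b) ->
      exists a m1 m2 b, [/\ D a, D m1, D m2, D b &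
        linked_around r q' s l u a m1 m2 b].
  case=> [nq _ <-] [ns _ <-] [nl _ <-] [nu _ <-] [a [m1 [m2 [b lab]]]].
  have [|[|n1 [|n2 [|n3 [|n4 [|? ?]]]]] //= ?] := eP 4 [:: nq; ns; nl; nu].
    by exists [:: a; m1; m2; b].
  by exists (e n1), (e n2), (e n3), (e n4).
have cD (A : set T) : countable (D `&` A).
  apply: (@sub_countable _ _ _ D); first by apply: subset_card_le; exact: subIsetl.
  by apply: countable_img; exact: countableP.
exists e; split => // x /andP[px xq] Dx.
have sub p' q' : p <= p' -> q' <= q -> countably_compact (segment p' q').
  move=> pp' qq'; apply: sub_countably_compact ccK; first exact: segment_closed.
  by move=> y /andP[py yq]; apply/andP; split; [exact: le_trans py|exact: le_trans yq _].
(* Let [a] and [b] be the supremum of [D] below [x] and its infimum above [x]. If they agree, [x] is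
   a limit from both sides; otherwise they bound a gap of [D]. *)
have [||a [/andP[pa ax] cla aub]] := ub_closure rT (sub p x (lexx _) xq) (cD (segment p x)).
- exact: subIsetr.
- by exists p; split => //; rewrite /segment /= lexx.
have [||b [/andP[xb bq] clb blb]] := lb_closure rT (sub x q px (lexx _)) (cD (segment x q)).
- exact: subIsetr.
- by exists q; split => //; rewrite /segment /= lexx xq.
have gap y : D y -> a < y -> b <= y.
  move=> Dy ay; have [yx|] := boolP (y <= x).
    suff : y <= a by rewrite (ray_leNgt rT) ay.
    by apply: aub; split => //; apply/andP; rewrite (le_trans pa (ltW ay)).
  rewrite -(ray_ltNge rT) => xy; have [yq|] := boolP (y <= q).
    by apply: blb; split => //; apply/andP; rewrite (ltW xy).
  by rewrite -(ray_ltNge rT) => qy; exact: le_trans bq (ltW qy).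
have cla' : closure (D `&` [set y | y <= a]) a.
  by apply: closureS cla => y [Dy yK]; split => //; apply: aub.
have clb' : closure (D `&` [set y | b <= y]) b.
  by apply: closureS clb => y [Dy yK]; split => //; apply: blb.
have : a <= b by exact: le_trans xb.
rewrite le_eqVlt => /predU1P[abE|ab].
  have xE : x = a by apply/eqP; rewrite eq_le ax andbT abE.
  split.
    rewrite {2}xE; apply: closureS cla => y [Dy /andP[py yx]]; split => //=.
    by rewrite py lt_neqAle yx andbT; apply/eqP => yxE; rewrite yxE in Dy.
  have {2}-> : x = b by rewrite xE.
  apply: closureS clb => y [Dy /andP[xy yq]]; split => //=.
  by rewrite yq andbT lt_neqAle xy andbT; apply/eqP => yxE; rewrite -yxE in Dy.
exfalso; have [Da|Da] := pselect (D a); have [Db|Db] := pselect (D b).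
- have [|m Dm /andP[am mb]] := D1 a b Da Db.
    exists x; rewrite !lt_neqAle ax xb !andbT.
    by apply/andP; split; apply/eqP => E; move: Dx; [rewrite -E|rewrite E].
  by have := gap m Dm am; rewrite (ray_leNgt rT) mb.
- apply: (no_gap_below (ray_space_dual rT) rr D3 Db Da ab _ clb').
  move=> y Dy yb; change (@Order.le _ T y a); rewrite (ray_leNgt rT); apply/negP.
  move=> /(gap _ Dy) bley.
  by have := lt_le_trans (yb : @Order.lt _ T y b) bley; rewrite ltxx.
- exact: (no_gap_below rT rr D2 Da Db ab gap cla').
- exact: (no_gap_around rT rr D4 Da Db ab gap cla' clb').
Qed.

(** Otherwise every sequence of good points has a strict good upper bound. The good points of a
    countable reflecting set [D] then have a supremum [a] outside [D], and links from [a] to a good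
    point beyond it reflect to links below [a]. *)
Lemma cofinal_sequence x0 : exists f : nat -> T,
  (forall n, x0 <= f n /\ countably_compact (segment x0 (f n))) /\
  (forall y, x0 <= y -> countably_compact (segment x0 y) ->
    exists n, y <= f n).
Proof.
pose good y := x0 <= y /\ countably_compact (segment x0 y).
apply: contrapT => nof.
have unb f : (forall n, good (f n)) -> exists y, good y /\ forall n : nat, f n < y.
  move=> fgood; apply: contrapT => nub; apply: nof; exists f; split => //.
  move=> y x0y ccy; apply: contrapT => ny; apply: nub; exists y; split => // n.
  by rewrite (ray_ltNge rT); apply/negP => yf; apply: ny; exists n.
have good0 : good x0.
  split => // C _ _ /(_ x0) []; first by rewrite /segment /= lexx.
  move=> A CA Ax0; exists [set A]; split; first by move=> _ ->.
    exact: finite_set1.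
  by move=> y; rewrite /segment /= -eq_le => /eqP <-; exists A.
pose P (i : nat) (ps ws : seq T) : Prop := match i, ps, ws with
  | 0, [::], [:: a] => a = x0
  | 1, [:: l], [:: m] => l < m /\ good m
  | 2, [:: q; l], [:: a; c] => [/\ l < a, a < c, good c & linked r q a a c]
  | _, _, _ => False end.
have [e eP] := elementary_enumeration x0 P.
pose D := range e; have De n : D (e n) by exists n.
have Dx0 : D x0.
  by have [|[|n1 [|? ?]] //= <-] := eP 0 [::]; first by exists [:: x0].
have D1 l : D l -> (exists m, l < m /\ good m) -> exists m, [/\ D m, l < m & good m].
  case=> nl _ <- [m lm]; have [|[|n1 [|? ?]] //= [? ?]] := eP 1 [:: nl].
    by exists [:: m].
  by exists (e n1).
have D2 q l : D q -> D l ->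
    (exists a c, [/\ l < a, a < c, good c & linked r q a a c]) ->
    exists a c, [/\ D c, l < a, a < c, good c & linked r q a a c].
  case=> [nq _ <-] [nl _ <-] [a [c lac]].
  have [|[|n1 [|n2 [|? ?]]] //= [? ? ? ?]] := eP 2 [:: nq; nl].
    by exists [:: a; c].
  by exists (e n1), (e n2).
(* Points of [D] that are not good are replaced by [x0], so that one bound serves all good points of
   [D]. *)
have [|y [[x0y ccy] yub]] := unb (fun n => if `[<good (e n)>] then e n else x0).
  by move=> n; case: asboolP.
have {}yub z : D z -> good z -> z < y.
  by case=> n _ <- gz; have := yub n; rewrite asboolT.
have [||| a [/andP[x0a ay] cla aub]] := @ub_closure _ _ rT (D `&` good) x0 y ccy.
- apply: (@sub_countable _ _ _ D); first by apply: subset_card_le; exact: subIsetl.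
  by apply: countable_img; exact: countableP.
- by move=> z [Dz gz]; apply/andP; split; [case: gz|exact: ltW (yub z Dz gz)].
- by exists x0.
have gooda : good a.
  split=> //; apply: sub_countably_compact ccy; first exact: segment_closed.
  by move=> z /andP[x0z za]; rewrite /segment /= x0z (le_trans za ay).
have Da : ~ D a.
  move=> Da; have [|m [Dm am gm]] := D1 a Da; first by exists y; split=> //; exact: yub.
  by have := aub m (conj Dm gm); rewrite (ray_leNgt rT) am.
(* The supremum [a] may equal [y], so a second bound is needed as the upper end of the link. *)
have [//|y' [gy' yy']] := unb (fun=> y).
have ay' : a < y' by apply: le_lt_trans ay (yy' 0).
have [q [Dq gq] qlink] := linked_closure rT rr ay' cla.
have lta z : D z -> good z -> z < a.
  move=> Dz gz; rewrite lt_neqAle aub // andbT; apply/eqP => za.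
  by rewrite za in Dz.
apply: (no_links_below rT rr Dq (lta _ Dq gq)) => l Dl ql la.
have [|a' [c' [Dc la' ac' gc' link']]] := D2 q l Dq Dl; first by exists a, y'.
by exists a', c'; split => //; exact: lta.
Qed.

End countable_order_dense.

Lemma coinitial_sequence d (T : POrderedTopological.type d)
    (r : set (set T) -> set (set T)) (x0 : T) :
    ray_space T -> mcm_operator r ->
  exists f : nat -> T,
    (forall n, f n <= x0 /\ countably_compact (segment (f n) x0)) /\
    (forall y, y <= x0 -> countably_compact (segment y x0) ->
      exists n, f n <= y).
Proof.
move=> rT rr.
have [f [fgood fub]] := @cofinal_sequence _ T^d r (ray_space_dual rT) rr x0.
exists f; split => [n|y yx0 ccy].
  by have := fgood n; rewrite segment_dual.
by apply: fub => //; rewrite segment_dual.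
Qed.

(** * Countably compact components *)

Section rays.
Context d (T : POrderedTopological.type d).
Implicit Types (x y z p q : T) (D C O : set T).

Definition order_fills D p q := forall x, p <= x <= q -> ~ D x ->
  closure (D `&` [set y | p <= y < x]) x /\
  closure (D `&` [set y | x < y <= q]) x.

Definition covered_by (I : Type) (e : I -> T) C :=
  forall y x, y <= x -> C y -> C x -> exists p q D,
    [/\ p <= y, x <= q, order_fills D p q & D `<=` range e].

(** The interior of the closed ray serves points with a neighborhood containing nothing below them,
    as in the Sorgenfrey topology, where open rays do not suffice. *)
Definition up_ray (I : Type) (e : I -> T) i (b : bool) :=
  if b then interior [set y | e i <= y] else [set y | e i < y].

Lemma up_ray_open (I : Type) (e : I -> T) i b :
  ray_space T -> open (up_ray e i b).
Proof. by case: b => -[_ op _] /=; [exact: open_interior|exact: op]. Qed.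

(** This is the lower half of a base at [x]. If [O] reaches below [x], it contains some [e i] there;
    if not, [x] is no limit from below, so it is itself some [e i]. *)
Lemma up_ray_sub (I : Type) (e : I -> T) C O x :
    covered_by e C -> ray_space T -> open O -> order_convex O -> O `<=` C ->
    O x ->
  exists i b, up_ray e i b x /\ forall z, up_ray e i b z -> z <= x -> O z.
Proof.
move=> eC rT oO cO OC Ox.
have below i : O (e i) -> e i < x ->
    exists i b, up_ray e i b x /\ forall z, up_ray e i b z -> z <= x -> O z.
  move=> Oe ex; exists i, false; split => // z /= ez zx.
  exact: cO Oe Ox (ltW ez) zx.
have meets D p y : closure (D `&` [set z | p <= z < y]) y -> O y ->
    exists z, [/\ D z, O z & z < y].
  move=> cly Oy; have [z [[Dz /andP[_ zy]] Oz]] := cly _ (open_nbhs_nbhs (conj oO Oy)).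
  by exists z.
have [[z Oz zx]|nbelow] := pselect (exists2 z, O z & z < x).
  have [p [q [D [pz xq fD De]]]] := eC z x (ltW zx) (OC _ Oz) (OC _ Ox).
  have [Dx|Dx] := pselect (D x); last first.
    have [|/(meets D)-/(_ Ox)[y [Dy Oy yx]] _] := fD x _ Dx.
      by rewrite xq (le_trans pz (ltW zx)).
    by have [i _ ei] := De _ Dy; apply: (below i); rewrite ei.
  (* If [z] is missing from [D], points of [D] accumulate at [z] from above, and one of them lies
     between [z] and [x]. *)
  have [Dz|Dz] := pselect (D z).
    by have [i _ ei] := De _ Dz; apply: (below i); rewrite ei.
  have [|_ clz] := fD z _ Dz; first by rewrite pz (le_trans (ltW zx) xq).
  have [_ _ ol] := rT.
  have [y [[Dy /andP[zy _]] yx]] := clz _ (open_nbhs_nbhs (conj (ol x) zx)).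
  have [i _ ei] := De _ Dy; apply: (below i); rewrite ei //.
  exact: cO Oz Ox (ltW zy) (ltW yx).
have [p [q [D [px xq fD De]]]] := eC x x (lexx _) (OC _ Ox) (OC _ Ox).
have [Dx|Dx] := pselect (D x); last first.
  have [|/(meets D)-/(_ Ox)[y [Dy Oy yx]] _] := fD x _ Dx; first by rewrite px.
  by case: nbelow; exists y.
have [i _ ei] := De _ Dx; exists i, true; split.
  rewrite /up_ray /interior /= ei; apply: filterS (open_nbhs_nbhs (conj oO Ox)).
  by move=> y Oy; rewrite /= (ray_leNgt rT); apply/negP => yx; apply: nbelow; exists y.
move=> z /interior_subset /=; rewrite ei => xz zx.
have xzE : x = z by apply/eqP; rewrite eq_le xz zx.
by rewrite -xzE.
Qed.

Lemma up_segment_nbhs O x : ray_space T -> open O -> O x ->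
  exists p, [/\ O p, p <= x & nbhs x [set y | p <= y]].
Proof.
move=> rT oO Ox; have [[z Oz zx]|nbelow] := pselect (exists2 z, O z & z < x).
  exists z; split=> //; first exact: ltW.
  have [_ op _] := rT; apply: filterS (open_nbhs_nbhs (conj (op z) zx)).
  by move=> y /ltW.
exists x; split => //; apply: filterS (open_nbhs_nbhs (conj oO Ox)) => y Oy /=.
by rewrite (ray_leNgt rT); apply/negP => yx; apply: nbelow; exists y.
Qed.

End rays.

Lemma covered_by_dual d (T : POrderedTopological.type d) (I : Type) (e : I -> T)
  (C : set T) : covered_by e C -> @covered_by _ T^d I e C.
Proof.
move=> eC y x yx Cy Cx; have [p [q [D [py xq fD De]]]] := eC x y yx Cx Cy.
exists q, p, D; split => // z /andP[qz zp] Dz.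
have [|clp clq] := fD z _ Dz; first by apply/andP; split.
split; first by apply: closureS clq => u [Du /andP[? ?]]; split => //; apply/andP; split.
by apply: closureS clp => u [Du /andP[? ?]]; split => //; apply/andP; split.
Qed.

Section components.
Context d (T : POrderedTopological.type d).
Hypothesis goT : GO_space T.
Hypothesis lccT : locally_countably_compact T.
Implicit Types (x y z p q : T) (D C O : set T).

Lemma convex_nbhs x U : nbhs x U ->
  exists O, [/\ open O, order_convex O, O x & O `<=` U].
Proof.
case: goT => _ _ [B [oB bB] cB] /(bB x)[ O [BO Ox] OU].
by exists O; split => //; [exact: oB|exact: cB].
Qed.

(** By the Hausdorff property [x] has a convex neighborhood missing [a], and by convexity it stays
    on the side of [a] where [x] lies. *)
Lemma GO_ray_space : ray_space T.
Proof.
have [tot hT _] := goT.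
have sep (a x : T) : a != x ->
    exists O, [/\ open O, order_convex O, O x & ~ O a].
  move=> ax; have : ~ cluster (nbhs a) x by move=> /hT E; rewrite E eqxx in ax.
  move=> /existsNP[A] /existsNP[B] /not_implyP[aA] /not_implyP[xB AB].
  have [ O [oO cO Ox OB]] := convex_nbhs xB.
  exists O; split => // Oa; apply: AB; exists a; split; [exact: nbhs_singleton|exact: OB].
split=> // a; rewrite openE => x /= ax.
  have [|O [oO cO Ox Oa]] := sep a x; first by rewrite lt_eqF.
  apply: filterS (open_nbhs_nbhs (conj oO Ox)) => y Oy /=.
  rewrite comparable_ltNge; last exact: tot.
  by apply/negP => ya; apply: Oa; exact: cO Oy Ox ya (ltW ax).
have [|O [oO cO Ox Oa]] := sep a x; first by rewrite gt_eqF.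
apply: filterS (open_nbhs_nbhs (conj oO Ox)) => y Oy /=.
rewrite comparable_ltNge; last exact: tot.
by apply/negP => ay; apply: Oa; exact: cO Ox Oy (ltW ax) ay.
Qed.

Let rT := GO_ray_space.

(** The union spares a case distinction on the order of [x] and [y]: the wrongly oriented segment is
    empty unless [x = y]. *)
Definition cc_related x y := countably_compact (segment x y `|` segment y x).

Lemma cc_related_closed x y : closed (segment x y `|` segment y x).
Proof. by apply: closedU; exact: segment_closed. Qed.

Lemma cc_relatedE x y : x <= y ->
  cc_related x y = countably_compact (segment x y).
Proof.
move=> xy; rewrite /cc_related; congr countably_compact.
apply/seteqP; split => z; last by left.
by case=> // /andP[yz zx]; apply/andP; rewrite (le_trans xy yz) (le_trans zx xy).
Qed.

Lemma cc_related_sym x y : cc_related x y -> cc_related y x.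
Proof. by rewrite /cc_related setUC. Qed.

Lemma cc_related_trans y x z : cc_related x y -> cc_related y z -> cc_related x z.
Proof.
move=> xy yz; apply: sub_countably_compact (countably_compactU xy yz).
  exact: cc_related_closed.
move=> t [] /andP[xt tz].
  case: (boolP (t <= y)) => [ty|]; first by left; left; apply/andP.
  rewrite -(ray_ltNge rT) => /ltW yt; right; left; exact/andP.
case: (boolP (t <= y)) => [ty|]; first by right; right; apply/andP.
by rewrite -(ray_ltNge rT) => /ltW yt; left; right; apply/andP.
Qed.

Lemma cc_related_nbhs x : nbhs x (cc_related x).
Proof.
have [K xK ccK] := lccT x; have [ O [oO cO Ox OK]] := convex_nbhs xK.
apply: filterS (open_nbhs_nbhs (conj oO Ox)) => y Oy.
apply: sub_countably_compact ccK; first exact: cc_related_closed.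
by move=> z [] /andP[xz zy]; apply: OK; [exact: cO Ox Oy xz zy|exact: cO Oy Ox xz zy].
Qed.

Lemma cc_related_refl x : cc_related x x.
Proof. exact: nbhs_singleton (cc_related_nbhs x). Qed.

Lemma cc_related_open x : open (cc_related x).
Proof.
rewrite openE => y xy; apply: filterS (cc_related_nbhs y) => z.
exact: cc_related_trans.
Qed.

Variable r : set (set T) -> set (set T).
Hypothesis rr : mcm_operator r.

(** Coinitial and cofinal sequences exhaust the class by countably many countably compact segments;
    the index [(m, n, k)] names point [k] of the enumeration for segment [(m, n)]. *)
Lemma component_covered x0 :
  exists e : nat * nat * nat -> T, covered_by e (cc_related x0).
Proof.
have [f [fgood fub]] := cofinal_sequence rT rr x0.
have [g [ggood glb]] := coinitial_sequence x0 rT rr.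
have gf m n : g m <= f n.
  by have [[gx _] [xf _]] := (ggood m, fgood n); exact: le_trans xf.
have /choice[E EP] : forall mn : nat * nat, exists e : nat -> T,
    order_fills (range e) (g mn.1) (f mn.2).
  move=> [m n] /=; have [||e [_ _ eP]] := @interval_enumeration _ T r rT rr (g m) (f n).
  - exact: gf.
  - have [[gx ccg] [xf ccf]] := (ggood m, fgood n).
    rewrite -cc_relatedE //; apply: (@cc_related_trans x0).
      by rewrite cc_relatedE.
    by rewrite cc_relatedE.
  by exists e.
exists (fun i => E i.1 i.2) => y x yx Cy Cx.
have [m my] : exists m, g m <= y.
  have [yx0|] := boolP (y <= x0).
    by apply: glb => //; rewrite -cc_relatedE //; exact: cc_related_sym.
  rewrite -(ray_ltNge rT) => /ltW xy.
  by exists 0; apply: le_trans xy; have [] := ggood 0.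
have [n xn] : exists n, x <= f n.
  have [x0x|] := boolP (x0 <= x).
    by apply: fub => //; rewrite -cc_relatedE.
  rewrite -(ray_ltNge rT) => /ltW xx.
  by exists 0; apply: le_trans xx _; have [] := fgood 0.
exists (g m), (f n), (range (E (m, n))); split => //.
by move=> _ [k _ <-]; exists (m, n, k).
Qed.

Lemma component_base x0 : exists B : nat -> set T,
  (forall n, open (B n)) /\
  forall x U, cc_related x0 x -> open U -> U x -> exists n, B n x /\ B n `<=` U.
Proof.
have [e ecov] := component_covered x0.
pose I := ((nat * nat * nat) * bool)%type.
pose B (ij : I * I) : set T := up_ray e ij.1.1 ij.1.2 `&`
  @up_ray _ T^d _ e ij.2.1 ij.2.2.
exists (fun n => if unpickle n is Some ij then B ij else set0); split.
  move=> n; case: (unpickle n) => [ij|]; last exact: open0.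
  apply: openI; first exact: up_ray_open.
  exact: (@up_ray_open _ T^d _ _ _ _ (ray_space_dual rT)).
move=> x U xx oU Ux.
have [|O [oO cO Ox OU]] := @convex_nbhs x (U `&` cc_related x0).
  by apply: open_nbhs_nbhs; split=> //; apply: openI => //; exact: cc_related_open.
have OC : O `<=` cc_related x0 by move=> y /OU[].
have [i [b [ibx ibO]]] := up_ray_sub ecov rT oO cO OC Ox.
have cOd : @order_convex _ T^d O.
  by move=> a y c Oa Oc ay yc; exact: cO Oc Oa yc ay.
have [j [b' [jbx jbO]]] :=
  up_ray_sub (covered_by_dual ecov) (ray_space_dual rT) oO cOd OC Ox.
exists (pickle ((i, b), (j, b'))); rewrite pickleK; split; first by split.
move=> z [iz jz]; suff /OU[] : O z by [].
have [zx|] := boolP (z <= x); first exact: ibO.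
by rewrite -(ray_ltNge rT) => /ltW xz; apply: jbO.
Qed.

(** A small segment around [x] is countably compact and lies in one class, where the countable base
    makes it compact. *)
Lemma GO_locally_compact : locally_compact [set: T].
Proof.
move=> x _; rewrite /locally_of /within /=.
have [K xK ccK] := lccT x.
have [ O [oO cO Ox OK]] : exists O, [/\ open O, order_convex O, O x &
    O `<=` K `&` cc_related x].
  by apply: convex_nbhs; apply: filterI => //; exact: cc_related_nbhs.
have [p [Op px pn]] := up_segment_nbhs rT oO Ox.
have [q [Oq xq qn]] := @up_segment_nbhs _ T^d O x (ray_space_dual rT) oO Ox.
have pqO : segment p q `<=` O by move=> y /andP[py yq]; exact: cO Op Oq py yq.
exists (segment p q).
  by apply: filterS (filterI pn qn) => y [? ?] _; apply/andP; split.
split; last exact: segment_closed.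
have [B [oB bB]] := component_base x.
apply: (countably_compact_compact oB).
  by move=> y U /pqO/OK[_ xy]; exact: bB.
apply: sub_countably_compact ccK; first exact: segment_closed.
by move=> y /pqO/OK[].
Qed.

End components.

(** * Metrization *)

Section metric_space_of_distance.
Local Open Scope ring_scope.
Context (R : realType) (M : choiceType) (dist : M -> M -> R).
Hypothesis distxx : forall x, dist x x = 0.
Hypothesis dist_eq0 : forall x y, dist x y = 0 -> x = y.
Hypothesis distC : forall x y, dist x y = dist y x.
Hypothesis distD : forall y x z, dist x z <= dist x y + dist y z.

(** The dummy [let] makes the type depend on the metric axioms, so that they can be recovered from
    it by the instance. *)
Definition distance_space : Type :=
  let _ := (distxx, dist_eq0, distC, distD) in M.
HB.instance Definition _ := Choice.on distance_space.
HB.instance Definition _ :=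
  isMetric.Build R distance_space distxx dist_eq0 distC distD.

Lemma nbhs_distance_space (x : distance_space) :
  nbhs x = filter_from [set e : R | 0 < e] (fun e => [set y | dist x y < e]).
Proof. by rewrite -metricType_numDomainType.filter_from_mdist_nbhs. Qed.

End metric_space_of_distance.

Lemma metrizable_distance (R : realType) (T : topologicalType)
    (dist : T -> T -> R) :
    (forall x, dist x x = 0)%R -> (forall x y, dist x y = 0 -> x = y)%R ->
    (forall x y, dist x y = dist y x) ->
    (forall y x z, dist x z <= dist x y + dist y z)%R ->
    (forall x : T, nbhs x =
      filter_from [set e : R | (0 < e)%R] (fun e => [set y | (dist x y < e)%R])) ->
  metrizable T R.
Proof.
move=> d0 d1 d2 d3 nE.
exists (distance_space d0 d1 d2 d3), id, id; split=> //.
  by move=> x A; rewrite nbhs_distance_space -nE.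
by move=> x A; rewrite nE -(@nbhs_distance_space R T dist d0 d1 d2 d3).
Qed.

Section separating_sequence.
Local Open Scope ring_scope.
Context (R : realType) (T : topologicalType).
Implicit Types (x y : T) (U : set T) (h : nat -> T -> R).

Definition separating_on (C : set T) h :=
  [/\ forall k, continuous (h k), forall k x, 0 <= h k x <= 1 &
    forall x U, C x -> open U -> U x -> exists k,
      h k x < 2^-1 /\ forall y, ~ U y -> h k y = 1].

(** One function is chosen for each pair of base sets that admits one. Complete regularity gives a
    function for [x] and [B m], and a base set around [x] on which it stays below one half. *)
Lemma ex_separating_on (C : set T) (B : nat -> set T) :
    completely_regular_space T -> (forall n, open (B n)) ->
    (forall x U, C x -> open U -> U x -> exists n, B n x /\ B n `<=` U) ->
  exists h, separating_on C h.
Proof.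
move=> crT oB bB.
pose good (f : T -> R) := continuous f /\ forall x, 0 <= f x <= 1.
pose sep n m (f : T -> R) :=
  (forall x, B n x -> f x < 2^-1) /\ forall y, ~ B m y -> f y = 1.
have /choice[F FP] : forall nm : nat * nat, exists f,
    good f /\ ((exists2 f', good f' & sep nm.1 nm.2 f') -> sep nm.1 nm.2 f).
  move=> [n m] /=; have [[f gf sf]|nf] := pselect (exists2 f, good f & sep n m f).
    by exists f.
  exists (fun=> 0); split => [|/nf//]; split; first exact: cst_continuous.
  by move=> x; rewrite lexx ler01.
exists (fun k => F (odflt (0, 0)%N (unpickle k))); split.
- by move=> k; have [[]] := FP (odflt (0, 0)%N (unpickle k)).
- by move=> k; have [[]] := FP (odflt (0, 0)%N (unpickle k)).
move=> x U Cx oU Ux.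
have [m [mx mU]] := bB x U Cx oU Ux.
have /(@uniform_separatorP _ R)[f [cf f01 fx f1]] :
    uniform_separator [set x] (~` B m).
  by apply: crT => //; exact: open_closedC.
have oV : open (f @^-1` [set z | z < 2^-1]).
  by apply: open_comp => [z _|]; [exact: cf|exact: open_lt].
have [|n [nx nV]] := bB x _ Cx oV.
  by rewrite /= (fx (f x)) ?invr_gt0 ?ltr0n //; exists x.
have [_ [|sepx sep1]] := FP (n, m).
  exists f; first split => //.
    by move=> y; have /= := f01 (f y); rewrite in_itv /=; apply; exists y.
  split => [y /nV//|y nBy]; apply: f1; exists y => //.
exists (pickle (n, m)); rewrite pickleK /=; split; first exact: sepx.
by move=> y nUy; apply: sep1 => /mU.
Qed.

End separating_sequence.

Section partition_distance.
Local Open Scope ring_scope.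
Context (R : realType) (T : topologicalType) (C : T -> set T).
Variable H : set T -> nat -> T -> R.
Hypothesis hausT : hausdorff_space T.
Hypothesis Crefl : forall x, C x x.
Hypothesis Ceq : forall x y, C x y -> C x = C y.
Hypothesis Copen : forall x, open (C x).
Hypothesis HC : forall x, separating_on (C x) (H (C x)).
Implicit Types x y z : T.

(** Dividing by [k.+1] makes the terms tend to 0 uniformly, so that their supremum induces the
    topology; it is at most 1, the distance between different classes. *)
Let gap x y k := `|H (C x) k x - H (C x) k y| / k.+1%:R.

Definition partition_dist x y :=
  if `[<C x y>] then sup (range (gap x y)) else 1.

Let gap_ge0 x y k : 0 <= gap x y k.
Proof. by rewrite divr_ge0. Qed.

Let gap_diff x y k : `|H (C x) k x - H (C x) k y| <= 1.
Proof.
have [_ h01 _] := HC x; have /andP[? ?] := h01 k x; have /andP[? ?] := h01 k y.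
by rewrite ler_norml; lra.
Qed.

Let gap_leV x y k : gap x y k <= k.+1%:R^-1.
Proof.
by rewrite -[leRHS]mul1r ler_wpM2r ?invr_ge0.
Qed.

Let gap_le1 x y k : gap x y k <= 1.
Proof. by apply: le_trans (gap_leV x y k) _; rewrite invf_le1 ?ltr0n ?ler1n. Qed.

Let gap_le x y k : C x y -> gap x y k <= partition_dist x y.
Proof.
move=> Cxy; rewrite /partition_dist asboolT //; apply: ub_le_sup; last by exists k.
by exists 1 => _ [j _ <-].
Qed.

Let dist_le x y e : C x y -> (forall k, gap x y k <= e) -> partition_dist x y <= e.
Proof.
move=> Cxy ge; rewrite /partition_dist asboolT //; apply: ge_sup.
  by exists (gap x y 0), 0.
by move=> _ [k _ <-].
Qed.

Let dist_ge0 x y : 0 <= partition_dist x y.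
Proof.
have [Cxy|nC] := pselect (C x y); last by rewrite /partition_dist asboolF.
by apply: le_trans (gap_le 0 Cxy).
Qed.

Let dist_le1 x y : partition_dist x y <= 1.
Proof.
have [Cxy|nC] := pselect (C x y); last by rewrite /partition_dist asboolF.
exact: dist_le.
Qed.

Let dist_sep x U : open U -> U x ->
  exists2 e, 0 < e & forall y, partition_dist x y < e -> U y.
Proof.
move=> oU Ux; have [_ h01 hsep] := HC x; have [k [hx hU]] := hsep x U (Crefl x) oU Ux.
(* Outside [U] function [k] jumps by more than one half. The radius is at most 1, so other classes
   are excluded too. *)
exists (2^-1 / k.+1%:R); first by rewrite divr_gt0 ?invr_gt0 ?ltr0n.
move=> y dxy; have [Cxy|nC] := pselect (C x y); last first.
  move: dxy; rewrite /partition_dist asboolF // ltNge => /negP[].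
  rewrite mulr_ile1 ?invr_ge0 // ?invf_le1 ?ltr0n ?ler1n //.
apply: contrapT => /hU hy.
have := le_lt_trans (gap_le k Cxy) dxy.
rewrite /gap ltr_pM2r ?invr_gt0 ?ltr0n // hy ltr_norml; lra.
Qed.

Lemma metrizable_partition : metrizable T R.
Proof.
apply: (metrizable_distance (dist := partition_dist)).
- move=> x; apply/eqP; rewrite eq_le dist_ge0 andbT; apply: dist_le => // k.
  by rewrite /gap subrr normr0 mul0r.
- move=> x y dxy; apply: contrapT => xy.
  have [||e e0 sep] := @dist_sep x (~` [set y]).
  + by apply: closed_openC; apply: accessible_closed_set1; exact: hausdorff_accessible.
  + by move=> /xy.
  by apply: (sep y) => //; rewrite dxy.
- move=> x y; have [Cxy|nC] := pselect (C x y); last first.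
    rewrite /partition_dist !asboolF // => Cyx; apply: nC.
    by rewrite -(Ceq Cyx).
  have Cyx : C y x by rewrite -(Ceq Cxy).
  rewrite /partition_dist !asboolT //; suff -> : gap x y = gap y x by [].
  by apply/funext => k; rewrite /gap (Ceq Cxy) distrC.
- move=> y x z; have [Cxy|nC] := pselect (C x y); last first.
    rewrite {2}/partition_dist asboolF //.
    by apply: le_trans (dist_le1 x z) _; rewrite lerDl.
  have [Cyz|nC] := pselect (C y z); last first.
    rewrite {3}/partition_dist asboolF //.
    by apply: le_trans (dist_le1 x z) _; rewrite lerDr.
  have Cxz : C x z by rewrite (Ceq Cxy).
  apply: dist_le => // k; apply: le_trans (lerD (gap_le k Cxy) (gap_le k Cyz)).
  by rewrite /gap -(Ceq Cxy) -mulrDl ler_wpM2r ?invr_ge0 // ler_distD.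
move=> x; apply/seteqP; split => U.
  rewrite nbhsE => -[V [oV Vx] VU]; have [e e0 eV] := dist_sep oV Vx.
  by exists e => // y /eV /VU.
move=> [e /= e0 eU]; apply: filterS eU _.
have e20 : 0 < e / 2 by rewrite divr_gt0.
(* Terms from [N] on are small by their denominators, the finitely many earlier ones by
   continuity. *)
have [N _ NE] := near_infty_natSinv_lt (PosNum e20).
have [hc _ _] := HC x.
have near_gap n : \forall y \near x, forall k, (k < n)%N -> gap x y k <= e / 2.
  elim: n => [|n IH]; first by apply: nearW.
  have : \forall y \near x, `|H (C x) n x - H (C x) n y| < e / 2.
    by have /cvgr_dist_lt := hc n x; apply.
  apply: filterS2 IH => y IH hy k; rewrite ltnS leq_eqVlt => /predU1P[->|/IH//].
  apply: le_trans (ltW hy); rewrite /gap ler_piMr // invf_le1 ?ltr0n ?ler1n //.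
apply: filterS2 (near_gap N) (open_nbhs_nbhs (conj (Copen x) (Crefl x))) => y ny Cxy.
apply: (@le_lt_trans _ _ (e / 2)); last by lra.
apply: dist_le => // k; have [kN|Nk] := ltnP k N; first exact: ny.
by apply: le_trans (gap_leV _ _ _) _; apply/ltW; exact: NE.
Qed.

End partition_distance.

(** * Compact LOTS as GO-spaces, and the conclusion *)

Lemma compact_countably_compact (T : topologicalType) (K : set T) :
  compact K -> countably_compact K.
Proof.
move=> cK C _ oC KC; apply: contrapT => nfin.
pose F : set_system T := [set A | exists D, [/\ D `<=` C, finite_set D &
  K `\` \bigcup_(B in D) B `<=` A]].
have FF : ProperFilter F.
  split.
    move=> [D [DC fD KD]]; apply: nfin; exists D; split => // x Kx.
    by apply: contrapT => Dx; exact: (KD x).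
  split.
  - by exists set0; split.
  - move=> A B [D [DC fD DA]] [E [EC fE EB]]; exists (D `|` E); split.
    + by move=> G [/DC|/EC].
    + by rewrite finite_setU.
    + by rewrite bigcup_setU => x [Kx /not_orP[Dx Ex]]; split; [exact: DA|exact: EB].
  - by move=> A B AB [D [DC fD DA]]; exists D; split => // x /DA /AB.
have [|x [Kx Fx]] := cK F FF.
  by exists set0; split => // x [].
have [A CA Ax] := KC _ Kx.
have FA : F (~` A).
  exists [set A]; split; [by move=> _ ->|exact: finite_set1|].
  by move=> y [_ nAy] Ay; apply: nAy; exists A.
have [y [nAy Ay]] := Fx _ _ FA (open_nbhs_nbhs (conj (oC _ CA) Ax)).
exact: nAy.
Qed.

Lemma LOTS_GO_space d (T : POrderedTopological.type d) : LOTS T -> GO_space T.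
Proof.
move=> [tot nE].
have itvN (i : interval T) x : itv_open_ends i -> x \in i -> nbhs x [set` i].
  by move=> oi xi; rewrite nE; exists i.
have sep (x y : T) : x < y -> ~ cluster (nbhs x) y.
  move=> xy clxy.
  (* The disjoint rays below [a] and above [b] separate [x] from [y]: both ends are a point in
     between, or [y] and [x] at a jump. *)
  have [a [b [xa bx' abd]]] : exists a b : T,
      [/\ x < a, b < y & forall t : T, t < a -> b < t -> False].
    have [[z /andP[xz zy]]|jump] := pselect (exists z, x < z < y).
      by exists z, z; split=> // t tz zt; have := lt_trans tz zt; rewrite ltxx.
    by exists y, x; split=> // t ty xt; apply: jump; exists t; rewrite xt.
  have [||t [/=]] := clxy [set` `]-oo, a[%O] [set` `]b, +oo[%O].
  - by apply: itvN; rewrite ?in_itv.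
  - by apply: itvN; rewrite ?in_itv //= andbT.
  by rewrite !in_itv /= andbT => ta /(abd t ta).
split=> //.
  move=> x y clxy; apply/eqP; apply: contraPT clxy => xy.
  have [|yx] : x < y \/ y < x.
    rewrite !lt_neqAle xy eq_sym xy /=.
      by have /orP[] := tot x y; [left|right].
    exact: sep.
  by move=> clxy; apply: (sep _ _ yx) => A B Ay Bx; rewrite setIC; exact: clxy.
exists [set [set` i] | i in [set i : interval T | itv_open_ends i]].
  split; first by move=> _ [i oi <-]; rewrite openE => x xi; exact: itvN.
  move=> x A; rewrite nE => -[i [oi xi] iA].
  by exists [set` i] => //; split=> //; exists i.
move=> _ [i _ <-] x y z /=; case: i => l u.
rewrite !itv_boundlr => /andP[lx _] /andP[_ zu] xy yz.
apply/andP; split; first by apply: le_trans lx _; rewrite bnd_simp.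
by apply: le_trans zu; rewrite bnd_simp.
Qed.

Lemma GO_metrizable (R : realType) d (T : POrderedTopological.type d) :
    GO_space T -> locally_countably_compact T ->
  monotonically_countably_metacompact T -> metrizable T R.
Proof.
move=> goT lccT [r rr]; have [_ hT _] := goT.
have crT : completely_regular_space T.
  exact: (@locally_compact_completely_regular T R) (GO_locally_compact goT lccT rr) hT.
(* Functions are chosen per class and not per point, so that related points share them and the
   distance is symmetric. *)
have /choice[H HP] : forall A : set T, exists h : nat -> T -> R,
    (exists x, A = @cc_related d T x) -> separating_on A h.
  move=> A; have [[x ->]|nA] := pselect (exists x, A = @cc_related d T x).
    have [B [oB bB]] := component_base goT lccT rr x.
    by have [h hP] := ex_separating_on R crT oB bB; exists h.
  by exists (fun _ _ => 0%R) => /nA.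
apply: (@metrizable_partition R T (@cc_related d T) H hT).
- exact: cc_related_refl.
- move=> x y xy; apply/seteqP; split => z.
    by apply: cc_related_trans => //; exact: cc_related_sym.
  exact: cc_related_trans.
- exact: cc_related_open.
- by move=> x; apply: HP; exists x.
Qed.

Local Close Scope order_scope.

Theorem theorem1p3 (R : realType) (d : Order.disp_t)
    (X : POrderedTopological.type d)
    (hX : (LOTS X /\ compact [set: X]) \/
          (GO_space X /\ locally_countably_compact X))
    (hm : monotonically_countably_metacompact X) :
  metrizable X R.
Proof.
case: hX => [[lX cX]|[gX lccX]]; last exact: GO_metrizable.
apply: GO_metrizable => //; first exact: LOTS_GO_space.
by move=> x; exists setT; [exact: filterT|exact: compact_countably_compact].
Qed.
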